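(* Let $A$ be a finite or countable alphabet, let $\theta$ be a literal (anti)morphism onto $A^*$, and let $X\subseteq A^*$ be a thin $\theta$-invariant code. Then the following are equivalent: (i) $X$ is complete; (ii) $X$ is a maximal code; (iii) $X$ is maximal in the family of $\theta$-invariant codes.
   Context: Standing assumption: $\theta:A^*\to A^*$ is a bijection, literal ($\theta(A)\subseteq A$), and either a morphism or an antimorphism ($\theta(\varepsilon)=\varepsilon$, $\theta(xy)=\theta(y)\theta(x)$). $X$ is $\theta$-invariant if $\theta(X)=X$. A code is a set $X$ such that any equation $x_1\cdots x_m=y_1\cdots y_n$ with $x_i,y_j\in X$ forces $m=n$ and $x_i=y_i$. $F(S)$ denotes the set of factors of words in $S$. $X$ is thin if $F(X)\ne A^*$, and complete if $F(X^* )=A^*$. A code is maximal (in a family) if it is not strictly contained in another code (of that family). *)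

(* Defs.v *)
From mathcomp Require Import all_boot.
From mathcomp Require Import boolp classical_sets.

Set Implicit Arguments.
Unset Strict Implicit.
Unset Printing Implicit Defensive.

Local Open Scope classical_set_scope.

(* The free monoid on the alphabet A is seq A: the product is ++, the empty
   word is [::], and the letter a is the one-letter word [:: a]. The alphabet
   is a countType, which covers finite (even empty) and countably infinite
   alphabets. *)

Definition word_morphism (A : Type) (theta : seq A -> seq A) : Prop :=
  theta [::] = [::] /\ forall x y, theta (x ++ y) = theta x ++ theta y.

Definition word_antimorphism (A : Type) (theta : seq A -> seq A) : Prop :=
  theta [::] = [::] /\ forall x y, theta (x ++ y) = theta y ++ theta x.

Definition literal (A : Type) (theta : seq A -> seq A) : Prop :=
  forall a : A, exists b : A, theta [:: a] = [:: b].

Definition invariant_under (A : Type) (theta : seq A -> seq A)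
    (X : set (seq A)) : Prop :=
  theta @` X = X.

Definition star (A : eqType) (X : set (seq A)) : set (seq A) :=
  [set w | exists2 xs : seq (seq A), (forall x, x \in xs -> X x) &
         w = flatten xs].

Definition factors (A : eqType) (S : set (seq A)) : set (seq A) :=
  [set u | exists2 w, S w & infix u w].

Definition thin (A : eqType) (X : set (seq A)) : Prop := factors X <> setT.

Definition complete (A : eqType) (X : set (seq A)) : Prop :=
  factors (star X) = setT.

(* The sequences xs and ys may be empty; allowing this does not change the
   notion, since a set containing the empty word is excluded in any case by
   flatten [:: [::]] = flatten [:: [::]; [::]]. *)
Definition code (A : eqType) (X : set (seq A)) : Prop :=
  forall xs ys : seq (seq A),
    (forall x, x \in xs -> X x) -> (forall y, y \in ys -> X y) ->
    flatten xs = flatten ys -> xs = ys.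

Definition maximal_in (T : Type) (F : set (set T)) (X : set T) : Prop :=
  F X /\ ~ exists2 Y, F Y & X `<` Y.

(* Main.v *)
(* Complete => maximal. Fix w outside F(X). If X is complete, then for every
   word u some g u d lies in star X, where g is a suffix and d a prefix of w:
   any factorization of a completion of w u w has a cut inside each copy of w.
   Hence, over any finite alphabet of k letters containing those of w, the sum
   of k^(-|v|) over v in star X diverges. If X together with some y outside X
   were a code, then (star X) y would also be a code, of infinite Kraft sum over
   the letters of w and y. Working over these letters only allows A to be
   infinite.

   Maximal among the theta-invariant codes => complete. Let w be outside
   F(star X) and let a <> b be letters. Adjoin to X all words c^N u c^N where u
   is outside F(star X), |u| = |b w b| = N - 1 and c differs from the first and
   from the last letter of u. These words form a theta-invariant set, also when
   theta reverses words, and the result is a code: the position of the leftmost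
   new word in a product is determined by the product. Over a one-letter
   alphabet an incomplete code is empty. *)
Require Import Defs.
From mathcomp Require Import all_boot all_order all_algebra.
From mathcomp Require Import boolp classical_sets.
From mathcomp Require Import zify ring lra.

Set Implicit Arguments.
Unset Strict Implicit.
Unset Printing Implicit Defensive.

Import Order.TTheory GRing.Theory Num.Theory.

(** * Kraft sums of finite sets of words over a finite alphabet *)

Section Kraft.
Local Open Scope ring_scope.
Variables (A : eqType) (B : seq A).

Fixpoint words (n : nat) : seq (seq A) :=
  if n is m.+1 then [seq b :: v | b <- B, v <- words m] else [:: [::]].

Lemma mem_words n v : (v \in words n) = (size v == n) && all (mem B) v.
Proof.
elim: n v => [|n IHn] [|a v] //=.
  by apply/allpairsP => -[[b u]] [].
rewrite eqSS; apply/allpairsP/idP => [[[b u]] [/= bB]|/and3P[sv aB vB]].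
  by rewrite IHn => /andP[su uB] [-> ->]; rewrite su uB andbT.
by exists (a, v); rewrite IHn sv vB.
Qed.

Lemma size_words n : size (words n) = (size B ^ n)%N.
Proof. by elim: n => //= n IHn; rewrite size_allpairs IHn expnS. Qed.

Lemma words_uniq n : uniq B -> uniq (words n).
Proof.
move=> uB; elim: n => //= n IHn.
by apply: allpairs_uniq => // -[a u] [b v] _ _ /= [-> ->].
Qed.

Definition words_lt (M : nat) : seq (seq A) :=
  [seq v | m <- iota 0 M, v <- words m].

Lemma mem_words_lt M v : (v \in words_lt M) = (size v < M)%N && all (mem B) v.
Proof.
apply/allpairsPdep/andP => [[m [u [+ + ->]]]|[sv vB]].
  by rewrite mem_iota mem_words => /andP[_ mM] /andP[/eqP -> ->].
by exists (size v), v; rewrite mem_iota mem_words eqxx.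
Qed.

Lemma words_lt_uniq M : uniq B -> uniq (words_lt M).
Proof.
move=> uB; apply: allpairs_uniq_dep => [|m _|]; rewrite ?iota_uniq ?words_uniq//.
move=> _ _ /allpairsPdep[m [u [_ + ->]]] /allpairsPdep[m' [u' [_ + ->]]] /= uu'.
by rewrite uu' !mem_words => /andP[/eqP <- _] /andP[/eqP <- _].
Qed.

Hypothesis B_gt0 : (0 < size B)%N.

Let q : rat := (size B)%:R^-1.

Let q_gt0 : 0 < q. Proof. by rewrite invr_gt0 ltr0n. Qed.

Let qexpK n : q ^+ n * (size B ^ n)%:R = 1.
Proof. by rewrite exprVn natrX mulVf// expf_neq0// pnatr_eq0 -lt0n. Qed.

(** Each length below [M] contributes at most 1: there are at most [size B ^ m] words of length [m],
    each of weight [q ^+ m]. The induction splits off the words of the greatest length. *)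
Lemma weight_le (M : nat) (s : seq (seq A)) :
  uniq s -> {subset s <= words_lt M} -> \sum_(v <- s) q ^+ size v <= M%:R.
Proof.
move=> us; elim: M s us => [|M IHM] s us sM.
  by case: s us sM => [|v s] _ sM; rewrite ?big_nil//; have := sM v (mem_head _ _).
rewrite (bigID (fun v => size v == M)) /= -2!(big_filter s) -natr1 addrC lerD//.
  apply: IHM => [|v]; first exact: filter_uniq.
  rewrite mem_filter => /andP[vM /sM]; rewrite !mem_words_lt => /andP[+ ->].
  by rewrite ltnS leq_eqVlt (negPf vM) /= andbT.
rewrite big_filter (eq_bigr (fun=> q ^+ M)) => [|v /eqP->//].
rewrite -big_filter big_const_seq count_predT iter_addr_0 -[leRHS](qexpK M).
rewrite -[leLHS]mulr_natr.
rewrite ler_pM2l ?exprn_gt0// ler_nat -size_words; apply: uniq_leq_size.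
  exact: filter_uniq.
move=> v; rewrite mem_filter mem_words => /andP[-> /sM].
by rewrite mem_words_lt => /andP[].
Qed.

Fixpoint powers (T : seq (seq A)) (r : nat) : seq (seq (seq A)) :=
  if r is r'.+1 then [seq t :: ts | t <- T, ts <- powers T r'] else [:: [::]].

Lemma sum_powers (T : seq (seq A)) (r : nat) :
  \sum_(ts <- powers T r) q ^+ size (flatten ts) =
  (\sum_(t <- T) q ^+ size t) ^+ r.
Proof.
elim: r => [|r IHr] /=; first by rewrite big_seq1.
rewrite big_allpairs_dep exprS mulr_suml /=; apply: eq_bigr => t _.
by rewrite -IHr mulr_sumr; apply: eq_bigr => ts _; rewrite size_cat exprD.
Qed.

Lemma powers_sub (T : seq (seq A)) (r : nat) ts :
  ts \in powers T r -> {subset ts <= T}.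
Proof.
elim: r ts => [|r IHr] ts /=; first by rewrite inE => /eqP->.
case/allpairsP => -[t u] [/= tT uT ->] x; rewrite inE => /orP[/eqP->//|].
exact: IHr.
Qed.

Lemma powers_flatten_lt (T : seq (seq A)) (M r : nat) ts :
  {subset T <= words_lt M} -> ts \in powers T r ->
  flatten ts \in words_lt (r * M).+1.
Proof.
move=> TM; elim: r ts => [|r IHr] ts /=; first by rewrite inE => /eqP->.
case/allpairsP => -[t u] [/= tT uT ->] /=.
move: (TM _ tT) (IHr _ uT); rewrite !mem_words_lt size_cat all_cat.
by move=> /andP[? ->] /andP[? ->]; rewrite andbT; lia.
Qed.

Lemma powers_uniq (T : seq (seq A)) (r : nat) : uniq T -> uniq (powers T r).
Proof.
move=> uT; elim: r => //= r IHr.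
by apply: allpairs_uniq => // -[a u] [b v] _ _ /= [-> ->].
Qed.

(* The r-fold products are pairwise distinct words of length at most r * M, so
   the r-th power of the Kraft sum is at most r * M + 1 for all r. *)
Lemma kraft_lt2 (M : nat) (T : seq (seq A)) :
  uniq T -> {subset T <= words_lt M} ->
  (forall ts us, {subset ts <= T} -> {subset us <= T} ->
     flatten ts = flatten us -> ts = us) ->
  \sum_(t <- T) q ^+ size t < 2%:R.
Proof.
move=> uT TM codeT; rewrite ltNge; apply/negP => sum_ge2.
have bound r : (2 ^ r <= (r * M).+1)%N.
  rewrite -(ler_nat rat) natrX.
  apply: (@le_trans _ _ ((\sum_(t <- T) q ^+ size t) ^+ r)).
    by rewrite lerXn2r// nnegrE// (le_trans _ sum_ge2).
  rewrite -sum_powers -(big_map flatten predT (fun v => q ^+ size v)).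
  apply: weight_le => [|_ /mapP[ts tsT ->]]; last exact: powers_flatten_lt tsT.
  rewrite map_inj_in_uniq ?powers_uniq// => ts us /powers_sub tsT /powers_sub usT.
  exact: codeT.
(* This exponent makes the left side a square [e ^ 2] with [e] larger than [2 * M + 1], while the
   right side is only [(2 * M + 1) * (2 * M) + 1]. *)
have := bound (2 * (2 * M).+1)%N; rewrite mulnC expnM.
have := ltn_expl (2 * M).+1 (isT : 1 < 2)%N.
by set e := (2 ^ _)%N => he; rewrite -mulnn; nia.
Qed.

End Kraft.

(** * Cuts in factorizations, and codes derived from a larger code *)

Section Factorizations.
Variable A : eqType.
Implicit Types (X Y : set (seq A)) (u v w : seq A).

Lemma star_nil X : star X [::].
Proof. by exists [::]. Qed.

Lemma star_sub X x : X x -> star X x.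
Proof.
move=> Xx; exists [:: x]; last by rewrite /= cats0.
by move=> y; rewrite inE => /eqP->.
Qed.

Lemma star_flatten X xs : (forall x, x \in xs -> X x) -> star X (flatten xs).
Proof. by exists xs. Qed.

Lemma code_nil X : code X -> ~ X [::].
Proof.
move=> cX X0; suff: [:: [::]] = [::] :> seq (seq A) by [].
by apply: cX => // x; rewrite inE => /eqP->.
Qed.

(** The first factor reaching beyond [p] must end inside [w], since otherwise it would contain [w];
    its end is the cut. *)
Lemma cut_flatten (xs : seq (seq A)) p w r :
  (forall x, x \in xs -> ~~ infix w x) -> flatten xs = p ++ w ++ r ->
  exists i xs1 xs2, [/\ xs = xs1 ++ xs2, flatten xs1 = p ++ take i w &
    flatten xs2 = drop i w ++ r].
Proof.
elim: xs p => [|x xs IHxs] p wxs /= e.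
  by case: p e => // e; exists 0, [::], [::]; rewrite take0 drop0.
case: p e => [|a p] e.
  by exists 0, [::], (x :: xs); rewrite take0 drop0.
have wx : ~~ infix w x by apply: wxs; rewrite mem_head.
case: (leqP (size x) (size (a :: p))) => xp.
  have e1 : x = take (size x) (a :: p).
    by have := congr1 (take (size x)) e; rewrite take_size_cat// takel_cat.
  have e2 : flatten xs = drop (size x) (a :: p) ++ w ++ r.
    have := congr1 (drop (size x)) e; rewrite drop_size_cat// drop_cat.
    by rewrite ltn_neqAle xp andbT; case: eqP => // ->; rewrite drop_size subnn drop0.
  have [y yxs|i [xs1 [xs2 [-> e3 e4]]]] := IHxs _ _ e2.
    by apply: wxs; rewrite inE yxs orbT.
  exists i, (x :: xs1), xs2; split => //=.
  rewrite -cat_cons e3 catA; congr (_ ++ _).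
  by rewrite -[RHS](cat_take_drop (size x)) -e1.
have e1 : x = (a :: p) ++ take (size x - size (a :: p)) (w ++ r).
  have := congr1 (take (size x)) e.
  by rewrite take_size_cat// => {1}->; rewrite take_cat ltnNge (ltnW xp).
have e2 : flatten xs = drop (size x - size (a :: p)) (w ++ r).
  have := congr1 (drop (size x)) e.
  by rewrite drop_size_cat// => {1}->; rewrite drop_cat ltnNge (ltnW xp).
move: e1 e2; set i := size x - _ => e1 e2.
have iw : i < size w.
  rewrite ltnNge; apply: contra wx => wi; apply/infixP.
  exists (a :: p), (take (i - size w) r); rewrite e1; congr (_ ++ _).
  rewrite take_cat ltnNge wi//=.
exists i, [:: x], xs; split=> //; last by rewrite e2 drop_cat iw.
by rewrite /= cats0 e1 takel_cat// ltnW.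
Qed.

(* Completing w u w forces a cut inside each copy of w. *)
Lemma complete_window X w u : complete X -> ~ factors X w ->
  exists i j, [/\ i <= size w, j <= size w & star X (drop i w ++ u ++ take j w)].
Proof.
move=> cX wX; have : factors (star X) (w ++ u ++ w) by rewrite cX.
case=> _ [xs Xxs ->] /infixP[p [s e]].
have wxs x : x \in xs -> ~~ infix w x.
  by move=> /Xxs Xx; apply/negP => wx; apply: wX; exists x.
rewrite -!catA in e.
have [i [xs1 [xs2 [e1 _ e2]]]] := cut_flatten wxs e.
have wxs2 x : x \in xs2 -> ~~ infix w x.
  by move=> xxs2; apply: wxs; rewrite e1 mem_cat xxs2 orbT.
rewrite catA in e2.
have [j [xs3 [xs4 [e3 e4 _]]]] := cut_flatten wxs2 e2.
have sX : star X (drop i w ++ u ++ take j w).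
  rewrite catA -e4; apply: star_flatten => x xxs3; apply: Xxs.
  by rewrite e1 e3 !mem_cat xxs3 orbT.
(* [cut_flatten] does not bound the cut positions; capping them at [size w] changes neither [drop]
   nor [take]. *)
exists (minn i (size w)), (minn j (size w)); split; rewrite ?geq_minr//.
have -> : drop (minn i (size w)) w = drop i w.
  by rewrite /minn; case: ltnP => // h; rewrite drop_size drop_oversize.
have -> : take (minn j (size w)) w = take j w.
  by rewrite /minn; case: ltnP => // h; rewrite take_size take_oversize.
by [].
Qed.

Lemma cat_cons_notin (T : eqType) (y : T) (s s' t t' : seq T) :
  y \notin s -> y \notin s' -> s ++ y :: t = s' ++ y :: t' -> s = s' /\ t = t'.
Proof.
elim: s s' => [|a s IHs] [|b s'] //=.
- by move=> _ _ [].
- by move=> _ + [e]; rewrite inE e eqxx.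
- by move=> + _ [e]; rewrite inE e eqxx.
rewrite !inE => /norP[_ ys] /norP[_ ys'] [-> e].
by have [-> ->] := IHs _ ys ys' e.
Qed.

(* In an unambiguous product of words of Y the occurrences of y can be read off,
   so (star X) y is again a code. *)
Lemma code_star_cat X Y y : code Y -> (X `<=` Y)%classic -> Y y -> ~ X y ->
  code [set u ++ y | u in star X].
Proof.
move=> cY XY Yy nXy.
have lift ts : (forall t, t \in ts -> [set u ++ y | u in star X]%classic t) ->
    exists2 ys, (forall x, x \in ys -> Y x) & flatten ys = flatten ts.
  elim: ts => [|t ts IHts] Tts; first by exists [::].
  have [|ys Yys /= <-] := IHts.
    by move=> x xts; apply: Tts; rewrite inE xts orbT.
  have [_ [xs Xxs ->] <-] := Tts t (mem_head _ _).
  exists (xs ++ y :: ys); last by rewrite flatten_cat /= catA.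
  move=> x; rewrite mem_cat inE => /or3P[/Xxs/XY//|/eqP->//|]; exact: Yys.
have y0 : y != [::] by apply/eqP => y0; move: Yy; rewrite y0; exact: code_nil.
have t0 t r : [set u ++ y | u in star X]%classic t -> t ++ r <> [::].
  by case=> u _ <-; case: (u) => //; case: (y) y0.
elim=> [|t ts IHts] [|t' ts'] // Tts Tts' /=.
- by move=> /esym /t0; case; exact: Tts' (mem_head _ _).
- by move=> /t0; case; exact: Tts (mem_head _ _).
have Tts1 x : x \in ts -> [set u ++ y | u in star X]%classic x.
  by move=> xts; apply: Tts; rewrite inE xts orbT.
have Tts1' x : x \in ts' -> [set u ++ y | u in star X]%classic x.
  by move=> xts; apply: Tts'; rewrite inE xts orbT.
have [_ [xs Xxs ->] <-] := Tts t (mem_head _ _).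
have [_ [xs' Xxs' ->] <-] := Tts' t' (mem_head _ _).
have [ys Yys eys] := lift _ Tts1; have [ys' Yys' eys'] := lift _ Tts1'.
move=> e.
(* Both sides are expanded into words of [Y]. As [y] is not in [X], its first occurrence marks the
   end of the first block on each side. *)
have e' : xs ++ y :: ys = xs' ++ y :: ys'.
  apply: cY.
  - by move=> x; rewrite mem_cat inE => /or3P[/Xxs/XY//|/eqP->//|]; exact: Yys.
  - by move=> x; rewrite mem_cat inE => /or3P[/Xxs'/XY//|/eqP->//|]; exact: Yys'.
  - by rewrite !flatten_cat /= eys eys' !catA.
have [] := cat_cons_notin _ _ e'; try by apply/negP; first [move/Xxs | move/Xxs'].
move=> -> eyy; congr (_ :: _); apply: IHts => //.
by rewrite -eys -eys' eyy.
Qed.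

End Factorizations.

(** * Divergence of the Kraft sum of [star X] *)

Section Divergence.
Local Open Scope ring_scope.
Variables (A : eqType) (B : seq A) (X : set (seq A)) (w : seq A).
Hypotheses (B_uniq : uniq B) (B_gt0 : (0 < size B)%N) (wB : {subset w <= B}).
Hypotheses (X_complete : complete X) (w_notin : ~ factors X w).

Let inX : pred (seq A) := fun v => `[<star X v>].
Let c (n : nat) : nat := count inX (words B n).
(** The proportion of words of length [n] over [B] lying in [star X], which is also what length [n]
    contributes to the Kraft sum. *)
Let a (n : nat) : rat := (c n)%:R / (size B)%:R ^+ n.

Let a_ge0 n : 0 <= a n.
Proof. by rewrite divr_ge0// exprn_ge0. Qed.

(** By [complete_window] every [u] of length [n] is counted for some pair of cuts, and for a fixed
    pair the map from [u] to [drop i w ++ u ++ take j w] is injective. *)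
Lemma count_words_le (n : nat) : (size B ^ n <=
  \sum_(i < (size w).+1) \sum_(j < (size w).+1) c (n + (size w - i) + j))%N.
Proof.
rewrite -size_words -sum1_size.
pose P i j u := inX (drop i w ++ u ++ take j w).
apply: (@leq_trans (\sum_(u <- words B n)
    \sum_(i < (size w).+1) \sum_(j < (size w).+1) P i j u)).
  apply: leq_sum => u _.
  have [i [j [iw jw sX]]] := complete_window u X_complete w_notin.
  rewrite (bigD1 (inord i))//= (bigD1 (inord j))//= !inordK ?ltnS//.
  by rewrite -addnA (_ : P i j u = true)//; apply/asboolP.
rewrite exchange_big leq_sum// => i _; rewrite exchange_big leq_sum// => j _ /=.
have -> : (\sum_(u <- words B n) P i j u = count (P i j) (words B n))%N.
  by rewrite -sum1_count [RHS]big_mkcond; apply: eq_bigr => u _; case: (P i j u).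
rewrite /c -!size_filter.
rewrite -(size_map (fun u => drop i w ++ u ++ take j w)); apply: uniq_leq_size.
  rewrite map_inj_in_uniq ?filter_uniq ?words_uniq// => u v _ _ /eqP.
  rewrite eqseq_cat// eqxx /= => /eqP e.
  have := congr1 (fun s => take (size s - size (take j w)) s) e.
  by rewrite !size_cat !addnK !take_size_cat.
move=> _ /mapP[u + ->]; rewrite !mem_filter => /andP[Pu].
rewrite !mem_words => /andP[/eqP su uB]; rewrite [inX _]Pu /=.
rewrite !size_cat su size_drop size_takel -1?ltnS// !all_cat uB.
rewrite addnA [(n + _)%N]addnC eqxx /=; apply/andP; split.
  by apply/allP => b /mem_drop /wB.
by apply/allP => b /mem_take /wB.
Qed.

(** Any [W] consecutive lengths contribute at least [1 / D], with [W] and [D] independent of where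
    the window starts. *)
Lemma star_weight_unbounded (C : nat) : exists M,
  C%:R <= \sum_(v <- words_lt B M | `[<star X v>]) (size B)%:R^-1 ^+ size v :> rat.
Proof.
set L := size w; pose W := (2 * L).+1; pose k : rat := (size B)%:R.
have k_ge1 : 1 <= k by rewrite ler1n.
have k_gt0 : 0 < k by rewrite (lt_le_trans ltr01).
(* The first factor counts the pairs of cuts; the second pays for the up to [2 * L] letters that a
   completion adds to [u]. *)
pose D := (L.+1 ^ 2 * size B ^ (2 * L))%N.
have window n : 1 <= D%:R * \sum_(n <= m < n + W) a m.
  have le_sum e : (e < W)%N -> (c (n + e))%:R <=
      k ^+ (n + 2 * L) * \sum_(n <= m < n + W) a m.
    move=> eW; rewrite (@le_trans _ _ (k ^+ (n + 2 * L) * a (n + e)))//.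
      rewrite /a mulrCA ler_peMr// ler_pdivlMr ?exprn_gt0// mul1r.
      by rewrite ler_weXn2l// leq_add2l -ltnS.
    rewrite ler_pM2l ?exprn_gt0// (bigD1_seq (n + e)%N) ?iota_uniq//=.
      by rewrite lerDl sumr_ge0.
    by rewrite mem_index_iota leq_addr ltn_add2l.
  rewrite -(ler_pM2l (exprn_gt0 n k_gt0)) mulr1 /D natrM [X in _ <= X]mulrA.
  have := count_words_le n; rewrite -(ler_nat rat) natrX => /le_trans; apply.
  rewrite natr_sum; apply: (@le_trans _ _ (\sum_(i < L.+1) \sum_(j < L.+1)
    (k ^+ (n + 2 * L) * \sum_(n <= m < n + W) a m))).
    apply: ler_sum => i _; rewrite natr_sum; apply: ler_sum => j _.
    rewrite -addnA; apply: le_sum; have := ltn_ord i; have := ltn_ord j.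
    by rewrite /W /L; lia.
  rewrite !sumr_const !card_ord -mulrnA -[leLHS]mulr_natr !natrM !natrX.
  rewrite exprD -/k le_eqVlt; apply/orP; left; apply/eqP.
  by set s := \sum_(_ <= _ < _) _; ring.
have sumS M : \sum_(v <- words_lt B M | inX v) k^-1 ^+ size v = \sum_(0 <= m < M) a m.
  rewrite big_mkcond big_allpairs_dep /= /index_iota subn0; apply: eq_bigr => m _.
  rewrite -big_mkcond big_seq_cond (eq_bigr (fun=> k^-1 ^+ m)) => [|v]; last first.
    by rewrite mem_words => /andP[/andP[/eqP-> _] _].
  by rewrite -big_seq_cond big_const_seq iter_addr_0 /a exprVn mulr_natl.
(* Room for [C * D] disjoint windows. *)
exists (C * D * W)%N; rewrite sumS.
have r_le r : r%:R <= D%:R * \sum_(0 <= m < r * W) a m.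
  elim: r => [|r IHr]; first by rewrite mul0n big_geq// mulr0.
  rewrite mulSn addnC (@big_cat_nat _ _ _ (r * W)%N) ?leq_addr//= mulrDr.
  by rewrite -natr1 lerD.
have D_gt0 : 0 < D%:R :> rat by rewrite ltr0n muln_gt0 !expn_gt0 B_gt0.
by rewrite -(ler_pM2l D_gt0) -natrM mulnC r_le.
Qed.

End Divergence.

Local Open Scope classical_set_scope.

(** * A thin complete set lies strictly inside no code *)

Lemma complete_maximal (A : eqType) (X Y : set (seq A)) :
  thin X -> complete X -> code Y -> ~ X `<` Y.
Proof.
move=> tX cX cY [XY nYX].
have [w wX] : exists w, ~ factors X w.
  by apply/existsNP => fX; apply: tX; apply/seteqP; split.
have [y Yy nXy] : exists2 y, Y y & ~ X y.
  apply: contrapT => /forall2NP h; apply: nYX => y Yy.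
  by have [//|/contrapT] := h y.
pose B := undup (w ++ y).
have wB : {subset w <= B} by move=> b bw; rewrite mem_undup mem_cat bw.
have yB : all (mem B) y by apply/allP => b bY; rewrite inE mem_undup mem_cat bY orbT.
have B_gt0 : 0 < size B.
  have : ~ y = [::] by move=> y0; apply: (code_nil cY); rewrite -y0.
  by case: (y) yB => // b ? /andP[+ _] _; rewrite inE; case: (B).
(* Appending [y] divides every weight by [size B ^ size y]. This factor compensates for it and
   leaves a sum of at least 2, which [kraft_lt2] forbids. *)
have [M] := star_weight_unbounded (undup_uniq _) B_gt0 wB cX wX
  (2 * size B ^ size y).
pose T := [seq v ++ y | v <- words_lt B M & `[<star X v>]].
have uT : uniq T.
  rewrite map_inj_in_uniq ?filter_uniq ?words_lt_uniq ?undup_uniq// => u v _ _ /eqP.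
  by move=> /eqP /(congr1 (fun s => take (size s - size y) s));
    rewrite !size_cat !addnK !take_size_cat.
have TM : {subset T <= words_lt B (M + size y)}.
  move=> _ /mapP[v + ->]; rewrite mem_filter !mem_words_lt => /and3P[_ vM vB].
  by rewrite size_cat all_cat vB yB ltn_add2r vM.
have TX t : t \in T -> [set u ++ y | u in star X] t.
  by case/mapP => v; rewrite mem_filter => /andP[/asboolP sv _] ->; exists v.
have := @kraft_lt2 _ _ B_gt0 _ T uT TM.
rewrite /T big_map big_filter.
have h ts us : {subset ts <= T} -> {subset us <= T} ->
    flatten ts = flatten us -> ts = us.
  move=> tsT usT; apply: (code_star_cat cY XY Yy nXy) => t.
    by move/tsT; exact: TX.
  by move/usT; exact: TX.
move=> /(_ h); under eq_bigr do rewrite size_cat exprD.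
rewrite -mulr_suml => lt2 le2.
have q_gt0 : (0 < ((size B)%:R ^+ size y : rat))%R by rewrite exprn_gt0// ltr0n.
move: lt2; rewrite exprVn ltr_pdivrMr// ltNge => /negP; apply.
by rewrite natrM natrX in le2.
Qed.

(** * Marker words that can be adjoined to an incomplete code *)

Section Markers.
Variable A : eqType.
Implicit Types (X : set (seq A)) (a : A) (u z : seq A).

(** The default [a] in [head] and [last] excludes an empty [u]. The runs are one letter longer than
    [u], so that none fits inside it. *)
Definition markers X m : set (seq A) :=
  [set z | exists a u, [/\ size u = m, head a u != a, last a u != a,
     ~ factors (star X) u & z = nseq m.+1 a ++ u ++ nseq m.+1 a]].

Lemma size_markers X m z : markers X m z -> size z = (m.+1 + (m + m.+1)).
Proof. by case=> a [u [su _ _ _ ->]]; rewrite !size_cat !size_nseq su. Qed.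

(* The run of m+1 equal letters opening z' cannot sit inside z except where the
   run is followed by the same letter again. *)
Lemma markers_overlap X m z z' x0 d : markers X m z -> markers X m z' ->
  0 < d < m.+1 + m ->
  (forall t, t <= m.+1 -> nth x0 z (d + t) = nth x0 z' t) -> False.
Proof.
case=> a [u [su ua _ _ ->]] [b [v [sv vb _ _ ->]]] /andP[d0 dm] e.
have m0 : 0 < m by case: m su ua {sv vb e dm} => // /size0nil->; rewrite eqxx.
have z'l t : t < m.+1 -> nth x0 (nseq m.+1 b ++ v ++ nseq m.+1 b) t = b.
  by move=> tm; rewrite nth_cat size_nseq tm nth_nseq tm.
have z'm : nth x0 (nseq m.+1 b ++ v ++ nseq m.+1 b) m.+1 != b.
  rewrite nth_cat size_nseq ltnn subnn nth_cat sv m0.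
  by rewrite (set_nth_default b) ?sv// nth0.
have zr t : m.+1 + m <= t < m.+1 + m + m.+1 ->
    nth x0 (nseq m.+1 a ++ u ++ nseq m.+1 a) t = a.
  move=> tm; rewrite catA nth_cat size_cat size_nseq su nth_nseq.
  by rewrite ltnNge ifN ?ifT//; lia.
(* For [d <= m] the opening run of [z'] starts within that of [z], so the letters agree, but it also
   covers the first letter of [u], which differs from [a]. *)
have [dN|dN] := leqP d m.
  have ab : a = b.
    have := e (m - d); rewrite subnKC// nth_cat size_nseq ltnSn nth_nseq ltnSn.
    by rewrite z'l; [apply|]; lia.
  have := e (m.+1 - d); rewrite subnKC; last by lia.
  rewrite z'l; last by lia.
  rewrite nth_cat size_nseq ltnn subnn nth_cat su m0 -ab.
  rewrite (set_nth_default a) ?su// nth0 => h.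
  by move: ua; rewrite h ?eqxx//; lia.
(* Now the opening run of [z'] ends within the closing run of [z], which still covers the next
   position, where [z'] has the first letter of [v]. *)
have ab : a = b.
  by have := e m; rewrite zr ?z'l//; [apply|]; lia.
by move: z'm; rewrite -e// zr ?ab ?eqxx//; lia.
Qed.

(** If [p'] were longer than [p], it would either stop before the end of the [u] in [z], against
    [markers_overlap], or contain this [u], which is no factor of [star X]. *)
Lemma markers_aligned X m p p' z z' r r' : markers X m z -> markers X m z' ->
  star X p' -> p ++ z ++ r = p' ++ z' ++ r' -> size p' <= size p.
Proof.
move=> Zz Zz' Xp' e; rewrite leqNgt; apply/negP => pp'.
pose d := size p' - size p.
have e1 : p' = p ++ take d (z ++ r).
  have := congr1 (take (size p')) e.
  by rewrite [RHS]take_size_cat// => <-; rewrite take_cat ltnNge (ltnW pp').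
have e2 : drop d (z ++ r) = z' ++ r'.
  have := congr1 (drop (size p')) e.
  by rewrite [RHS]drop_size_cat// => <-; rewrite [RHS]drop_cat ltnNge (ltnW pp').
have sz := size_markers Zz; have sz' := size_markers Zz'.
have [dm|dm] := leqP (m.+1 + m) d; last first.
  have x0 : A by case: (z) sz => [|x ?] //; exact: x.
  apply: (markers_overlap (x0 := x0) Zz Zz' (d := d)) => [|t tm].
    by rewrite dm subn_gt0 pp'.
  have := congr1 (fun s => nth x0 s t) e2.
  rewrite nth_drop !nth_cat !ifT// ?sz ?sz'; lia.
case: Zz => a [u [su _ _ nu zE]]; apply: nu; exists p' => //.
rewrite e1; apply/infixP.
exists (p ++ nseq m.+1 a), (take (d - (m.+1 + m)) (nseq m.+1 a ++ r)).
rewrite -!catA; congr (_ ++ _); rewrite zE catA -catA take_cat size_cat size_nseq su.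
by rewrite ltnNge dm /= -!catA.
Qed.

Lemma split_first_marker X (Z : set (seq A)) xs :
  (forall x, x \in xs -> (X `|` Z) x) ->
  (forall x, x \in xs -> X x) \/
  exists xs0 z xs1, [/\ xs = xs0 ++ z :: xs1, forall x, x \in xs0 -> X x & Z z].
Proof.
elim: xs => [|x xs IHxs] XZ; first by left.
have [|Zx] := XZ x (mem_head _ _); last by right; exists [::], x, xs.
have [|Xxs Xx|[xs0 [z [xs1 [-> Xxs0 Zz]]]] Xx] := IHxs.
- by move=> y yxs; apply: XZ; rewrite inE yxs orbT.
- by left => y; rewrite inE => /orP[/eqP->|/Xxs].
right; exists (x :: xs0), z, xs1; split => // y.
by rewrite inE => /orP[/eqP->|/Xxs0].
Qed.

Lemma markers_notin_star X m z p r : markers X m z -> ~ star X (p ++ z ++ r).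
Proof.
case=> a [u [_ _ _ nu ->]] Xz; apply: nu.
exists (p ++ (nseq m.+1 a ++ u ++ nseq m.+1 a) ++ r) => //.
apply/infixP; exists (p ++ nseq m.+1 a), (nseq m.+1 a ++ r).
by rewrite -!catA.
Qed.

(** [markers_aligned], used in both directions, puts the leftmost markers at the same place. They
    have equal length, hence coincide; [X] being a code settles what precedes them and induction
    what follows. *)
Lemma code_markers X m : code X -> code (X `|` markers X m).
Proof.
move=> cX xs; have [n] := ubnP (size xs).
elim: n xs => // n IHn xs xsn ys XZxs XZys e.
have [Xxs|[xs0 [z [xs1 [xsE Xxs0 Zz]]]]] := split_first_marker XZxs;
  have [Xys|[ys0 [z' [ys1 [ysE Xys0 Zz']]]]] := split_first_marker XZys.
- exact: cX.
- have := star_flatten Xxs; rewrite e ysE flatten_cat /=.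
  by move/(markers_notin_star Zz').
- have := star_flatten Xys; rewrite -e xsE flatten_cat /=.
  by move/(markers_notin_star Zz).
move: e; rewrite xsE ysE !flatten_cat /= => e.
have s0 : size (flatten xs0) = size (flatten ys0).
  apply/eqP; rewrite eqn_leq (markers_aligned Zz' Zz (star_flatten Xxs0) (esym e)).
  exact: markers_aligned Zz Zz' (star_flatten Xys0) e.
move/eqP: e; rewrite eqseq_cat// => /andP[/eqP e0].
rewrite eqseq_cat ?(size_markers Zz) ?(size_markers Zz')// => /andP[/eqP zz' /eqP e1].
rewrite (cX xs0 ys0)// zz' (IHn xs1 _ ys1)//.
- by move: xsn; rewrite xsE size_cat /=; lia.
- by move=> x xxs; apply: XZxs; rewrite xsE mem_cat inE xxs !orbT.
- by move=> x xxs; apply: XZys; rewrite ysE mem_cat inE xxs !orbT.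
Qed.

(** Take [b w b] as core: it still contains [w], and both its end letters differ from [a]. *)
Lemma markers_exist X a b w : a != b -> ~ factors (star X) w ->
  exists z, markers X (size w).+2 z.
Proof.
move=> ab wX; exists (nseq (size w).+3 a ++ (b :: rcons w b) ++ nseq (size w).+3 a).
have ba : b != a by rewrite eq_sym.
exists a, (b :: rcons w b); split=> //=.
- by rewrite size_rcons.
- by rewrite last_rcons.
case=> v Xv /infixP[p [r e]]; apply: wX; exists v => //; apply/infixP.
by exists (p ++ [:: b]), (b :: r); rewrite e -cats1 -!catA /= -catA.
Qed.

End Markers.

(** * Literal morphisms and antimorphisms acting on words and markers *)

Section LiteralMaps.
Variable A : eqType.
Implicit Types (X : set (seq A)) (theta : seq A -> seq A).

Definition acts_letterwise theta (sigma : A -> A) : Prop :=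
  theta =1 map sigma \/ theta =1 rev \o map sigma.

Lemma literal_letterwise theta : literal theta ->
  word_morphism theta \/ word_antimorphism theta ->
  exists sigma, acts_letterwise theta sigma.
Proof.
move=> /choice[sigma sigmaE] theta_mor; exists sigma.
case: theta_mor => -[theta0 thetaM]; [left|right]; elim=> [|a u IHu] //=.
  by rewrite -cat1s thetaM sigmaE IHu.
by rewrite -cat1s thetaM sigmaE IHu /= rev_cons cats1.
Qed.

Lemma letterwise1 theta sigma a :
  acts_letterwise theta sigma -> theta [:: a] = [:: sigma a].
Proof. by case=> ->. Qed.

Lemma letterwise_size theta sigma u :
  acts_letterwise theta sigma -> size (theta u) = size u.
Proof. by case=> ->; rewrite /= ?size_rev size_map. Qed.

Lemma factors_star_letterwise theta sigma X u : acts_letterwise theta sigma ->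
  (forall x, X x -> X (theta x)) -> factors (star X) u ->
  factors (star X) (theta u).
Proof.
move=> thetaE Xtheta [_ [xs Xxs ->] /infixP[p [s e]]].
have Xmap x : x \in map theta xs -> X x by case/mapP => y /Xxs/Xtheta + ->.
exists (theta (flatten xs)).
  case: thetaE => thetaE; rewrite thetaE /=.
    by rewrite map_flatten -(eq_map thetaE); exact: star_flatten.
  rewrite map_flatten rev_flatten -map_comp -map_rev.
  rewrite -(eq_map thetaE) map_rev; apply: star_flatten => x.
  by rewrite mem_rev; exact: Xmap.
apply/infixP; case: thetaE => thetaE; rewrite !thetaE e /=.
  by exists (map sigma p), (map sigma s); rewrite !map_cat.
exists (rev (map sigma s)), (rev (map sigma p)).
by rewrite !map_cat !rev_cat catA.
Qed.

(** The shape of a marker is symmetric, so reversal only exchanges the conditions on the first and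
    last letters; injectivity of [sigma] preserves them. *)
Lemma markers_letterwise theta sigma X m z : acts_letterwise theta sigma ->
  injective sigma ->
  (forall u, factors (star X) (theta u) -> factors (star X) u) ->
  markers X m z -> markers X m (theta z).
Proof.
move=> thetaE sigma_inj Xtheta [a [u [su ua ul nu ->]]].
exists (sigma a), (theta u); split; rewrite ?(letterwise_size _ thetaE)//.
- case: thetaE => ->; case: u ua ul {su nu} => [|b u] /=; rewrite ?eqxx// => ba ul.
    by rewrite inj_eq.
  by rewrite -nth0 nth_rev ?size_map//= subn1 nth_last /= last_map inj_eq.
- case: thetaE => ->; case: u ua ul {su nu} => [|b u] /=; rewrite ?eqxx// => ba ul.
    by rewrite last_map inj_eq.
  by rewrite rev_cons last_rcons inj_eq.
- by move/Xtheta.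
case: thetaE => thetaE; rewrite !thetaE ?[(rev \o _) _]/comp.
  by rewrite !map_cat !map_nseq.
by rewrite !map_cat !rev_cat !map_nseq !rev_nseq catA.
Qed.

(** [theta] preserves lengths, so the preimage of a letter is a letter. *)
Lemma literal_morphism_inverse theta theta' :
  cancel theta theta' -> cancel theta' theta -> literal theta ->
  word_morphism theta \/ word_antimorphism theta ->
  literal theta' /\ (word_morphism theta' \/ word_antimorphism theta').
Proof.
move=> thetaK theta'K theta_lit theta_mor.
have [sigma thetaE] := literal_letterwise theta_lit theta_mor.
split.
  move=> b; have := letterwise_size (theta' [:: b]) thetaE; rewrite theta'K.
  by case: (theta' [:: b]) => [|a [|? ?]]// _; exists a.
case: theta_mor => -[theta0 thetaM]; [left|right]; split.
- by rewrite -[X in theta' X]theta0 thetaK.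
- by move=> x y; rewrite -{1}[x]theta'K -{1}[y]theta'K -thetaM thetaK.
- by rewrite -[X in theta' X]theta0 thetaK.
- by move=> x y; rewrite -{1}[x]theta'K -{1}[y]theta'K -thetaM thetaK.
Qed.

(** Supplies the larger code in the one-letter case. *)
Lemma code_letters : code [set [:: a] | a in @setT A].
Proof.
have letters xs : (forall x, x \in xs -> [set [:: a] | a in @setT A] x) ->
    xs = [seq [:: a] | a <- flatten xs].
  elim: xs => // x xs IHxs lxs /=.
  have [a _ <-] := lxs x (mem_head _ _); rewrite /= -IHxs// => y yxs.
  by apply: lxs; rewrite inE yxs orbT.
by move=> xs ys /letters xsE /letters ysE e; rewrite xsE e -ysE.
Qed.

End LiteralMaps.

(** * Enlarging an incomplete invariant code, and the equivalence *)

Lemma maximal_invariant_complete (A : eqType) (theta : seq A -> seq A)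
    (X : set (seq A)) :
  bijective theta -> literal theta ->
  word_morphism theta \/ word_antimorphism theta ->
  maximal_in [set Y | code Y /\ invariant_under theta Y] X -> complete X.
Proof.
move=> [theta' thetaK theta'K] theta_lit theta_mor [[cX iX] mX].
apply: contrapT => ncX; apply: mX.
have [w wX] : exists w, ~ factors (star X) w.
  by apply/existsNP => fX; apply: ncX; apply/seteqP; split.
have [theta'_lit theta'_mor] :=
  literal_morphism_inverse thetaK theta'K theta_lit theta_mor.
have [sigma thetaE] := literal_letterwise theta_lit theta_mor.
have [tau theta'E] := literal_letterwise theta'_lit theta'_mor.
have sigmaK : cancel sigma tau.
  move=> a; have := thetaK [:: a].
  by rewrite (letterwise1 _ thetaE) (letterwise1 _ theta'E) => -[].
have tauK : cancel tau sigma.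
  move=> a; have := theta'K [:: a].
  by rewrite (letterwise1 _ theta'E) (letterwise1 _ thetaE) => -[].
have Xtheta x : X x -> X (theta x) by move=> Xx; rewrite -iX; exists x.
have Xtheta' x : X x -> X (theta' x).
  by rewrite -{1}iX => -[y Xy <-]; rewrite thetaK.
(* Each of these two facts brings a factor back from its image under the other map, so both maps
   send non-factors to non-factors. *)
have fX u := factors_star_letterwise thetaE Xtheta (u := u).
have fX' u := factors_star_letterwise theta'E Xtheta' (u := u).
have invariant Z : (forall z, Z z -> Z (theta z)) ->
    (forall z, Z z -> Z (theta' z)) -> invariant_under theta Z.
  move=> Ztheta Ztheta'; apply/seteqP; split=> [_ [z Zz <-]|z Zz]; first exact: Ztheta.
  by exists (theta' z); [exact: Ztheta'|].
have [[a [b ab]]|one_letter] := pselect (exists a b : A, a != b).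
  have [z Zz] := markers_exist ab wX.
  exists (X `|` markers X (size w).+2).
    split; first exact: code_markers.
    rewrite /invariant_under image_setU iX (invariant (markers _ _))// => y.
      apply: (markers_letterwise thetaE (can_inj sigmaK)) => u /fX'.
      by rewrite thetaK.
    apply: (markers_letterwise theta'E (can_inj tauK)) => u /fX.
    by rewrite theta'K.
  split=> [x|XZ]; first by left.
  have := markers_notin_star (p := [::]) (r := [::]) Zz; apply.
  by rewrite /= cats0; apply: star_sub; apply: XZ; right.
have nseqE (a : A) u : u = nseq (size u) a.
  apply/all_pred1P/allP => b _; apply: contrapT => /negP ba.
  by apply: one_letter; exists b, a.
(* The empty word is a factor of [star X], so [w] is nonempty and the alphabet has a letter. *)
have [a _] : exists a, a \in w.
  case: (w) wX => [|a v _]; last by exists a; rewrite mem_head.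
  by case; exists [::]; [exact: star_nil|].
exists [set [:: c] | c in @setT A].
  split; first exact: code_letters.
  by apply: invariant => _ [c _ <-];
    rewrite (letterwise1 _ thetaE, letterwise1 _ theta'E); eexists.
(* Over one letter, the power of a nonempty [x] with exponent [size w] is at least as long as [w],
   hence contains it. *)
have X0 x : ~ X x.
  move=> Xx; apply: wX; exists (flatten (nseq (size w) x)).
    by apply: star_flatten => y; rewrite mem_nseq => /andP[_ /eqP->].
  have sx : size w <= size (flatten (nseq (size w) x)).
    rewrite size_flatten /shape map_nseq sumn_nseq leq_pmull// lt0n size_eq0.
    by apply/eqP => x0; apply: (code_nil cX); rewrite -x0.
  apply/infixP; exists [::], (nseq (size (flatten (nseq (size w) x)) - size w) a).
  by rewrite /= {2}(nseqE a w) -nseqD subnKC// -nseqE.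
by split=> [x /X0//|/(_ [:: a]) h]; apply: (X0 [:: a]); apply: h; exists a.
Qed.

Theorem theorem3 (A : countType) (theta : seq A -> seq A)
    (theta_bij : bijective theta) (theta_lit : literal theta)
    (theta_mor : word_morphism theta \/ word_antimorphism theta)
    (X : set (seq A)) (X_thin : thin X) (X_inv : invariant_under theta X)
    (X_code : code X) :
  [<-> complete X;
       maximal_in [set Y | code Y] X;
       maximal_in [set Y | code Y /\ invariant_under theta Y] X].
Proof.
tfae.
- move=> X_complete; split=> // -[Y Y_code].
  exact: complete_maximal X_thin X_complete Y_code.
- move=> [_ X_max]; split=> // -[Y [Y_code _] XY].
  by apply: X_max; exists Y.
- exact: maximal_invariant_complete.
Qed.
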